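(* Let $G$ be a finite EPPO group, and let $H\neq\{e\}$ be a subgroup of $G$. Then $\Gamma_{G,H}$ is the disjoint union of graphs $X(n_p,m_p)$, with $n_p=|\Omega_p(G)|$ and $m_p=|\Omega_p(G)\setminus\Omega_p(H)|$, where $p$ runs over the prime divisors of $|G|$.
   Context: For a finite group $G$ with identity $e$ and a subgroup $H\neq\{e\}$ of $G$, the generalized non-coprime graph $\Gamma_{G,H}$ is the simple undirected graph with vertex set $G\setminus\{e\}$ in which two distinct vertices $a,b$ are adjacent if and only if $\gcd(|a|,|b|)\neq 1$ and ($a\in H$ or $b\in H$), where $|a|$ denotes the order of the element $a$. An EPPO group is a group in which every element has prime power order. For a group $K$ and a prime $p$, $\Omega_p(K)$ is the set of non-identity elements of $p$-power order in $K$. $X(n,m)$ (with $m\leq n$) denotes the complete graph on $n$ vertices with the edges of a complete graph on $m$ of its vertices removed. *)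

(* Defs.v *)
From HB Require Import structures.
From mathcomp Require Import all_boot all_fingroup all_solvable.

Set Implicit Arguments.
Unset Strict Implicit.
Unset Printing Implicit Defensive.

Local Open Scope group_scope.

Record sgraph := SGraph {
  vertex :> finType;
  adj : rel vertex;
  adj_sym : symmetric adj;
  adj_irrefl : irreflexive adj
}.

Definition graph_iso (A B : sgraph) : Prop :=
  exists2 f : A -> B, bijective f & forall x y : A, adj (f x) (f y) = adj x y.

Section Complete.
Variable n : nat.
Definition complete_adj : rel 'I_n := fun i j => i != j.

Lemma complete_adj_sym : symmetric complete_adj.
Proof. by move=> i j; rewrite /complete_adj eq_sym. Qed.

Lemma complete_adj_irrefl : irreflexive complete_adj.
Proof. by move=> i; rewrite /complete_adj eqxx. Qed.

Definition complete : sgraph := SGraph complete_adj_sym complete_adj_irrefl.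
End Complete.

(* The [m] chosen vertices are those of index [< m]; this is the intended
   graph only when [m <= n]. *)
Section X.
Variables n m : nat.
Definition X_adj : rel 'I_n :=
  fun i j => @adj (complete n) i j && ~~ ((i < m) && (j < m)).

Lemma X_adj_sym : symmetric X_adj.
Proof. by move=> i j; rewrite /X_adj adj_sym [(i < m) && _]andbC. Qed.

Lemma X_adj_irrefl : irreflexive X_adj.
Proof. by move=> i; rewrite /X_adj adj_irrefl. Qed.

Definition X : sgraph := SGraph X_adj_sym X_adj_irrefl.
End X.

(* Since [tagged_as u v] is [v] transported to the component of [u] when the
   tags agree, [u] and [v] are adjacent iff they lie in the same component and
   are adjacent there. *)
Section DisjointUnion.
Variables (I : finType) (F : I -> sgraph).
Definition disjoint_union_adj : rel {i : I & F i} :=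
  fun u v => (tag u == tag v) && adj (tagged u) (tagged_as u v).

Lemma disjoint_union_adj_sym : symmetric disjoint_union_adj.
Proof.
move=> [i x] [j y]; rewrite /disjoint_union_adj /= eq_sym.
by case: eqP => //= eij; case: _ / eij x => x; rewrite !tagged_asE adj_sym.
Qed.

Lemma disjoint_union_adj_irrefl : irreflexive disjoint_union_adj.
Proof.
by move=> [i x]; rewrite /disjoint_union_adj /= tagged_asE adj_irrefl andbF.
Qed.

Definition disjoint_union : sgraph :=
  SGraph disjoint_union_adj_sym disjoint_union_adj_irrefl.
End DisjointUnion.

Section NonCoprimeGraph.
Variables (gT : finGroupType) (G H : {group gT}).
Definition noncoprime_adj : rel {x : gT | x \in G^#} := fun a b =>
  [&& a != b, gcdn #[val a] #[val b] != 1%N & (val a \in H) || (val b \in H)].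

Lemma noncoprime_adj_sym : symmetric noncoprime_adj.
Proof. by move=> a b; rewrite /noncoprime_adj eq_sym gcdnC orbC. Qed.

Lemma noncoprime_adj_irrefl : irreflexive noncoprime_adj.
Proof. by move=> a; rewrite /noncoprime_adj eqxx. Qed.

Definition noncoprime_graph : sgraph :=
  SGraph noncoprime_adj_sym noncoprime_adj_irrefl.
End NonCoprimeGraph.

(* The identity, of order [p ^ 0], counts as having prime power order. *)
Definition EPPO (gT : finGroupType) (G : {group gT}) : Prop :=
  forall x, x \in G -> exists p k : nat, prime p /\ #[x] = (p ^ k)%N.

Definition Omega (gT : finGroupType) (p : nat) (K : {group gT}) : {set gT} :=
  [set x in K^# | p.-elt x].

(* Main.v *)
Require Import Defs.
From HB Require Import structures.
From mathcomp Require Import all_boot all_fingroup all_solvable.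

Set Implicit Arguments.
Unset Strict Implicit.
Unset Printing Implicit Defensive.

Local Open Scope group_scope.

(** In an EPPO group every non-identity element is a p-element for exactly one
    prime p, so the sets Omega_p(G), for p dividing |G|, partition the vertices.
    Two vertices in different parts have coprime orders and are not adjacent.
    Two distinct vertices in the same part have orders which are both divisible
    by p, so they are adjacent unless both lie outside H; and the elements of
    Omega_p(G) outside H are exactly Omega_p(G) \ Omega_p(H). Hence each part
    is a complete graph with a complete subgraph removed.

    Since the removed clique of [X n m] is on the first [m] indices,
    [enum_from] lists Omega_p(G) with Omega_p(G) \ Omega_p(H) at the front. The
    isomorphism is built in the direction from the disjoint union to the
    non-coprime graph, sending the index [i] of the component [p] to the [i]-th
    entry of that list: in this direction injectivity and surjectivity are
    the uniqueness and the existence of the prime, and no index has to be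
    transported between components. *)

(** [graph_iso] asks for a map [B -> A], whereas the convenient map goes out of
    [A]; surjectivity replaces the construction of an explicit inverse. *)
Lemma graph_iso_of_surj (A B : sgraph) (g : A -> B) :
    injective g -> (forall y, exists x, g x == y) ->
    (forall x y, adj (g x) (g y) = adj x y) ->
  graph_iso B A.
Proof.
move=> g_inj g_surj g_adj; pose f y := xchoose (g_surj y).
have fK : cancel f g by move=> y; apply/eqP/(xchooseP (g_surj y)).
exists f; first by exists g => // x; apply: g_inj; rewrite fK.
by move=> x y; rewrite -g_adj !fK.
Qed.

Section EnumFrom.
Variables (T : finType) (A D : {set T}).

Definition enum_from : seq T := enum D ++ enum (A :\: D).

Lemma enum_from_uniq : uniq enum_from.
Proof.
rewrite cat_uniq !enum_uniq andbT /=; apply/hasPn => x.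
by rewrite !mem_enum inE => /andP[].
Qed.

Hypothesis sDA : D \subset A.

Lemma mem_enum_from x : (x \in enum_from) = (x \in A).
Proof.
rewrite mem_cat !mem_enum inE.
by case: (boolP (x \in D)) => [/(subsetP sDA)->|].
Qed.

Lemma size_enum_from : size enum_from = #|A|.
Proof.
by rewrite size_cat -!cardE cardsD (setIidPr sDA) subnKC // subset_leq_card.
Qed.

Lemma nth_enum_from_front x0 i :
  i < #|A| -> (nth x0 enum_from i \in D) = (i < #|D|).
Proof.
move=> lt_iA; rewrite nth_cat -cardE; case: ltnP => [lt_iD | le_Di].
  by rewrite -mem_enum mem_nth -?cardE.
apply/negbTE; have: nth x0 (enum (A :\: D)) (i - #|D|) \in A :\: D.
  rewrite -mem_enum mem_nth // -cardE cardsD (setIidPr sDA).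
  by rewrite ltn_sub2r // (leq_ltn_trans le_Di).
by rewrite inE => /andP[].
Qed.

End EnumFrom.

Section Omega.
Variables (gT : finGroupType) (G H : {group gT}).
Implicit Types (p q : nat) (x y : gT).

Lemma p_elt_dvd_order p x : p.-elt x -> x != 1 -> p %| #[x].
Proof.
move=> p_x ntx; have := pdiv_dvd #[x]; rewrite -order_gt1 in ntx.
by have /(pnatPpi p_x)/eqnP-> : pdiv #[x] \in \pi(#[x]) by rewrite pi_pdiv.
Qed.

Lemma Omega_gcdn_neq1 p q x y : prime p -> prime q ->
  x \in Omega p G -> y \in Omega q G -> (gcdn #[x] #[y] != 1%N) = (p == q).
Proof.
move=> p_pr q_pr; rewrite !inE => /andP[/andP[ntx _] p_x] /andP[/andP[nty _] q_y].
case: (eqVneq p q) => [eq_pq | neq_pq]; last first.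
  apply/negbTE; rewrite negbK; apply: (pnat_coprime p_x).
  by apply: sub_in_pnat q_y => r _ /eqnP->; rewrite !inE eq_sym.
rewrite -eq_pq in q_y; apply: contraTneq p_pr => gcd1.
have : p %| 1 by rewrite -gcd1 dvdn_gcd !p_elt_dvd_order.
by rewrite dvdn1 => /eqP->.
Qed.

(** Excluding the identity is what makes the prime of the EPPO condition a
    divisor of |G|: that condition allows any prime for an element of order 1. *)
Lemma EPPO_Omega x : EPPO G -> x \in G^# ->
  exists2 p, p \in primes #|G| & x \in Omega p G.
Proof.
move=> eppoG Gx; have /setD1P[ntx xG] := Gx.
have [p [k [p_pr ox]]] := eppoG x xG.
have p_x : p.-elt x by rewrite /p_elt ox pnatX pnat_id.
exists p; last by rewrite inE Gx.
rewrite mem_primes p_pr cardG_gt0.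
exact: dvdn_trans (p_elt_dvd_order p_x ntx) (order_dvdG xG).
Qed.

Lemma mem_Omega_diff p x :
  x \in Omega p G -> (x \in Omega p G :\: Omega p H) = (x \notin H).
Proof. by rewrite !inE => /andP[/andP[-> ->] ->]; rewrite !andbT. Qed.

End Omega.

Theorem theorem4p1 (gT : finGroupType) (G H : {group gT}) :
  EPPO G -> H \subset G -> H :!=: 1 ->
  graph_iso (noncoprime_graph G H)
    (@disjoint_union (seq_sub (primes #|G|)) (fun p =>
       X #|Omega (ssval p) G| #|Omega (ssval p) G :\: Omega (ssval p) H|)).
Proof.
move=> eppoG _ _.
pose s p := enum_from (Omega p G) (Omega p G :\: Omega p H).
have sDO p : Omega p G :\: Omega p H \subset Omega p G by apply: subsetDl.
set U := disjoint_union _.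
pose e (u : U) := nth 1 (s (ssval (tag u))) (tagged u).
have e_size (u : U) : tagged u < size (s (ssval (tag u))).
  by rewrite size_enum_from.
have eO (u : U) : e u \in Omega (ssval (tag u)) G.
  by rewrite -(mem_enum_from (sDO _)) mem_nth.
have eG (u : U) : e u \in G^# by have:= eO u; rewrite inE => /andP[].
have pr (u : U) : prime (ssval (tag u)).
  by have:= ssvalP (tag u); rewrite mem_primes => /andP[].
(* Non-coprimality of orders detects the component; [e_inj] uses this also at
   [v = u], to recover the component of [u] from [e u]. *)
have e_tag (u v : U) : (gcdn #[e u] #[e v] != 1%N) = (tag u == tag v).
  by rewrite (Omega_gcdn_neq1 (pr u) (pr v) (eO u) (eO v)).
have e_inj : injective e.
  move=> u v eq_uv; have /eqP : tag u == tag v.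
    by rewrite -e_tag eq_uv e_tag.
  case: u v eq_uv => p i [q j] /= eq_ij eq_pq; case: _ / eq_pq j eq_ij => j.
  rewrite /e /= => /eqP; rewrite nth_uniq ?enum_from_uniq ?size_enum_from //.
  by move=> /eqP/val_inj->.
pose g (u : U) : noncoprime_graph G H := exist _ (e u) (eG u).
apply: (@graph_iso_of_surj _ _ g).
- by move=> u v /(congr1 val); apply: e_inj.
- case=> x Gx; have [p pG Ox] := EPPO_Omega eppoG Gx.
  have sx : x \in s p by rewrite mem_enum_from.
  have lt_x : index x (s p) < #|Omega p G|.
    by rewrite -(size_enum_from (sDO p)) index_mem.
  exists (Tagged (fun p : seq_sub (primes #|G|) =>
       X #|Omega (ssval p) G| #|Omega (ssval p) G :\: Omega (ssval p) H|)
     (Ordinal lt_x : X _ _) (i := SeqSub pG)).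
  by rewrite -val_eqE /= /e /= nth_index.
move=> u v; rewrite /= /noncoprime_adj /disjoint_union_adj /= e_tag.
have -> : (g u != g v) = (u != v) by rewrite -val_eqE /= (inj_eq e_inj).
have e_front (w : U) :
    (e w \in H) =
    ~~ (tagged w < #|Omega (ssval (tag w)) G :\: Omega (ssval (tag w)) H|).
  rewrite -(nth_enum_from_front (sDO _) 1) ?ltn_ord //.
  by rewrite mem_Omega_diff ?negbK ?eO.
rewrite !e_front; case: u v => p i [q j] /=.
case: (eqVneq p q) => [eq_pq | _]; last by rewrite andbF.
case: _ / eq_pq j => j.
by rewrite tagged_asE eq_Tagged /= /X_adj /= /complete_adj negb_and.
Qed.
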